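(* Let $A\in\mathbb{Z}^{k\times N}$, and let $R=\mathbb{C}[x_1,\dots,x_N]$ be $\mathbb{Z}^k$-graded by letting $\deg(x_i)=Ae_i$ be the $i$-th column of $A$; assume every graded component $R_s$, $s\in\mathbb{Z}^k$, is finite dimensional over $\mathbb{C}$. Let $\omega=\{s\in\mathbb{Z}^k:R_s\neq 0\}$, let $\omega_{\mathbb{R}}\subseteq\mathbb{R}^k$ be its positive hull, and let $B\in\mathbb{Z}^{p\times k}$ satisfy $\omega_{\mathbb{R}}=\{y\in\mathbb{R}^k:By\ge 0\}$; assume $\omega=\omega_{\mathbb{R}}\cap\mathbb{Z}^k$. Let $m\in\omega$. Then the procedure $\mathrm{SortLatticePoints}(A,B,m)$ terminates, and its output is a linear extension of the partial order $\preceq_\omega$ on $\omega_m=\{s\in\omega:s\preceq_\omega m\}$ (i.e. an ordered list of all elements of $\omega_m$, each appearing once, in which $s$ precedes $s'$ whenever $s\preceq_\omega s'$ and $s\ne s'$).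
   Context: The component $R_s$ is the $\mathbb{C}$-span of the monomials $x^\alpha$, $\alpha\in(\mathbb{Z}_{\ge0})^N$, with $A\alpha=s$. Finite dimensionality of all $R_s$ is equivalent to $R_0=\mathbb{C}$. The partial order on $\omega$ is $s_1\preceq_\omega s_2\iff s_2-s_1\in\omega$. Vector inequalities are componentwise; under the stated hypotheses $\omega_m=\{s\in\mathbb{Z}^k:Bm\ge Bs\ge 0\}$. $e_i$ is the $i$-th standard basis vector of $\mathbb{Z}^N$. Procedure $\mathrm{SortLatticePoints}(A,B,m)$: 1. Let $\mathrm{Unsorted}:=\{s\in\omega:s\preceq_\omega m\}\setminus\{0\}$ (the nonzero integral solutions $s$ of $Bm\ge Bs\ge 0$), and let $\mathrm{Sorted}$ be the ordered list $\{0\}$. 2. For every $s\in\mathrm{Unsorted}$, check for every $i=1,\dots,N$ whether (a) $s-Ae_i\in\mathrm{Sorted}$, or (b) $B(s-Ae_i)\not\ge 0$ (so $s-Ae_i\notin\omega$). 3. If for every $i$ at least one of (a), (b) holds, then append $s$ to the end of $\mathrm{Sorted}$ and delete it from $\mathrm{Unsorted}$. 4. Repeat steps 2 and 3 until $\mathrm{Unsorted}$ is empty; return $\mathrm{Sorted}$. *)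

(* Defs.v *)
From mathcomp Require Import all_boot all_order all_algebra.
From mathcomp Require Import mpoly complex.
From mathcomp Require Import boolp classical_sets cardinality reals.

Set Implicit Arguments.
Unset Strict Implicit.
Unset Printing Implicit Defensive.

Import Order.TTheory GRing.Theory Num.Theory.
Local Open Scope classical_set_scope.
Local Open Scope ring_scope.

Definition lspan (K : fieldType) (V : lmodType K) (S : set V) : set V :=
  [set p | exists n (c : 'I_n -> K) (v : 'I_n -> V),
     (forall i, S (v i)) /\ p = \sum_(i < n) c i *: v i].

(* [{mpoly K[n]}] is not a [vectType], so finite dimensionality of a subspace
   is the existence of a finite spanning family. *)
Definition finite_dim (K : fieldType) (V : lmodType K) (W : set V) : Prop :=
  exists n (b : 'I_n -> V), W = lspan (range b).

(* The degree A alpha of x^alpha: deg x_i is the i-th column of A. *)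
Definition multideg (k N : nat) (A : 'M[int]_(k, N)) (a : 'X_{1..N}) :
    'cV[int]_k :=
  A *m (\col_(i < N) (a i)%:Z).

Definition graded_piece (R : realType) (k N : nat) (A : 'M[int]_(k, N))
    (s : 'cV[int]_k) : set {mpoly R[i][N]} :=
  lspan [set p | exists2 a : 'X_{1..N}, multideg A a = s & p = 'X_[a]].
Arguments graded_piece R {k N} A s.

Definition omega (R : realType) (k N : nat) (A : 'M[int]_(k, N)) :
    set 'cV[int]_k :=
  [set s | exists2 p, graded_piece R A s p & p != 0].

Definition int_vec (R : realType) (k : nat) (s : 'cV[int]_k) : 'cV[R]_k :=
  map_mx intr s.

Definition pos_hull (R : realType) (k : nat) (S : set 'cV[R]_k) :
    set 'cV[R]_k :=
  [set y | exists n (c : 'I_n -> R) (v : 'I_n -> 'cV[R]_k),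
     [/\ forall i, 0 <= c i, forall i, S (v i)
       & y = \sum_(i < n) c i *: v i]].

Definition omega_real (R : realType) (k N : nat) (A : 'M[int]_(k, N)) :
    set 'cV[R]_k :=
  pos_hull [set int_vec R s | s in omega R A].
Arguments omega_real R {k N} A.

Definition vec_ge0 (K : numDomainType) (n : nat) (v : 'cV[K]_n) : bool :=
  [forall i, 0 <= v i 0].

Definition prec_omega (R : realType) (k N : nat) (A : 'M[int]_(k, N))
    (s1 s2 : 'cV[int]_k) : Prop :=
  omega R A (s2 - s1).

Definition omega_below (R : realType) (k N : nat) (A : 'M[int]_(k, N))
    (m : 'cV[int]_k) : set 'cV[int]_k :=
  [set s | omega R A s /\ prec_omega R A s m].

(* A state of the procedure is the pair (Unsorted, Sorted). *)
Definition state (k : nat) : Type := (seq 'cV[int]_k * seq 'cV[int]_k)%type.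

Definition ready (k N p : nat) (A : 'M[int]_(k, N)) (B : 'M[int]_(p, k))
    (sorted : seq 'cV[int]_k) (s : 'cV[int]_k) : bool :=
  [forall i : 'I_N,
     (s - col i A \in sorted) || ~~ vec_ge0 (B *m (s - col i A))].

Definition visit (k N p : nat) (A : 'M[int]_(k, N)) (B : 'M[int]_(p, k))
    (st : state k) (s : 'cV[int]_k) : state k :=
  if ready A B st.2 s then (rem s st.1, rcons st.2 s) else st.

(* One round of steps 2 and 3.  The order in which Unsorted is traversed is
   unspecified, hence arbitrary and possibly different in each round.  Since
   [ready] is monotone in Sorted, testing all elements against the Sorted list
   as it stood at the start of the round is also covered: it amounts to
   visiting first the elements that are not ready at that moment. *)
Definition pass (k N p : nat) (A : 'M[int]_(k, N)) (B : 'M[int]_(p, k))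
    (st st' : state k) : Prop :=
  exists2 u : seq 'cV[int]_k,
    perm_eq u st.1 & st' = foldl (visit A B) st u.

Definition unsorted0 (R : realType) (k N : nat) (A : 'M[int]_(k, N))
    (m : 'cV[int]_k) : set 'cV[int]_k :=
  omega_below R A m `\ 0.

(* The sequence of states after 0, 1, 2, ... rounds, for some scheduling; it is
   continued past the halting time, where rounds no longer change anything. *)
Definition sort_run (R : realType) (k N p : nat) (A : 'M[int]_(k, N))
    (B : 'M[int]_(p, k)) (m : 'cV[int]_k) (run : nat -> state k) : Prop :=
  [/\ uniq (run 0%N).1,
      forall s, s \in (run 0%N).1 <-> unsorted0 R A m s,
      (run 0%N).2 = [:: 0]
    & forall n, pass A B (run n) (run n.+1)].

Definition run_returns (k : nat) (run : nat -> state k)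
    (out : seq 'cV[int]_k) : Prop :=
  exists n : nat,
    [/\ forall j : nat, (j < n)%N -> (run j).1 <> [::],
        (run n).1 = [::] & (run n).2 = out].

(* Every run returns.  Finiteness of the initial Unsorted set is required
   separately, because without it the set could not be listed and there would
   be no run at all. *)
Definition sort_terminates (R : realType) (k N p : nat) (A : 'M[int]_(k, N))
    (B : 'M[int]_(p, k)) (m : 'cV[int]_k) : Prop :=
  finite_set (unsorted0 R A m) /\
  forall run, sort_run R A B m run -> exists out, run_returns run out.

Definition sort_output (R : realType) (k N p : nat) (A : 'M[int]_(k, N))
    (B : 'M[int]_(p, k)) (m : 'cV[int]_k) (out : seq 'cV[int]_k) : Prop :=
  exists2 run, sort_run R A B m run & run_returns run out.

Definition linear_extension (T : eqType) (le : T -> T -> Prop) (X : set T)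
    (l : seq T) : Prop :=
  [/\ uniq l, forall s, s \in l <-> X s
    & forall s s', X s -> X s' -> le s s' -> s <> s' ->
        (index s l < index s' l)%N].

(* Main.v *)
(** A monomial lies in the graded piece of its multidegree, so omega is the
    monoid generated by the columns of A, and finite dimensionality of a graded
    piece bounds the degrees of the monomials in it.  This makes omega_m finite
    and forces A a = 0 to imply a = 0.  By the two hypotheses on the cone, the
    test B s >= 0 decides membership in omega.

    A round can only get stuck if every unsorted s has some unsorted s - A e_i;
    since this step lowers the largest degree of a monomial of multidegree s,
    the descent stops at an element that is ready, hence every round shortens
    Unsorted.  In the Sorted list, each s comes after all s - A e_i in omega;
    chaining such steps along s' - s = A c shows that s precedes s'. *)

Require Import Defs.
From mathcomp Require Import all_boot all_order all_algebra.
From mathcomp Require Import mpoly complex.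
From mathcomp Require Import boolp classical_sets cardinality reals.

Set Implicit Arguments.
Unset Strict Implicit.
Unset Printing Implicit Defensive.

Import Order.TTheory GRing.Theory Num.Theory.
Local Open Scope classical_set_scope.
Local Open Scope ring_scope.

(** * Additivity of the multidegree *)

Section Degrees.
Variables (k N : nat) (A : 'M[int]_(k, N)).

Lemma multidegD (a b : 'X_{1..N}) :
  multideg A (a + b)%MM = multideg A a + multideg A b.
Proof.
rewrite /multideg -mulmxDr; congr (_ *m _).
by apply/colP=> i; rewrite !mxE mnmDE PoszD.
Qed.

Lemma multideg0 : multideg A 0%MM = 0.
Proof.
rewrite /multideg -[RHS](mulmx0 1 A); congr (_ *m _).
by apply/colP=> i; rewrite !mxE mnm0E.
Qed.

Lemma multidegU (i : 'I_N) : multideg A U_(i)%MM = col i A.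
Proof.
rewrite /multideg colE; congr (_ *m _).
by apply/colP=> j; rewrite !mxE mnm1E eqxx andbT eq_sym; case: eqP.
Qed.

Lemma multidegMn (a : 'X_{1..N}) n : multideg A (a *+ n)%MM = multideg A a *+ n.
Proof.
elim: n => [|n IHn]; first by rewrite mulm0n multideg0.
by rewrite mulmS multidegD IHn mulrS.
Qed.

Lemma mnm_neq0_split (c : 'X_{1..N}) :
  c <> 0%MM -> exists i c', c = (c' + U_(i))%MM.
Proof.
move=> /eqP; rewrite -mdeg_eq0 mdegE sum_nat_eq0 negb_forall => /existsP[i /= ci].
exists i, (c - U_(i))%MM; rewrite submK //.
by apply/mnm_lepP=> j; rewrite mnm1E; case: eqP => [<-|//]; rewrite lt0n.
Qed.

End Degrees.

(** * The monoid [omega] and the consequences of finite dimensionality *)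

Section WeightMonoid.
Variables (R : realType) (k N : nat) (A : 'M[int]_(k, N)).

Lemma graded_piece_monomial (a : 'X_{1..N}) :
  graded_piece R A (multideg A a) 'X_[a].
Proof.
exists 1%N, (fun=> 1), (fun=> 'X_[a]); split; first by move=> _; exists a.
by rewrite big_ord1 scale1r.
Qed.

Lemma omegaP s : omega R A s <-> exists a, multideg A a = s.
Proof.
split=> [[p [[|n] [c [v [vs ->]]]]]|[a <-]].
(* An empty combination is zero, so a nonzero element involves at least one monomial of degree
   [s]. *)
- by rewrite big_ord0 eqxx.
- by move=> _; have [a] := vs ord0; exists a.
- exists 'X_[a]; first exact: graded_piece_monomial.
  by rewrite -msize_poly_eq0 msizeX.
Qed.

Lemma omega0 : omega R A 0.
Proof. by apply/omegaP; exists 0%MM; rewrite multideg0. Qed.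

Lemma omegaD s t : omega R A s -> omega R A t -> omega R A (s + t).
Proof.
move=> /omegaP[a <-] /omegaP[b <-]; apply/omegaP.
by exists (a + b)%MM; rewrite multidegD.
Qed.

Lemma omega_col i : omega R A (col i A).
Proof. by apply/omegaP; exists U_(i)%MM; rewrite multidegU. Qed.

(** Each monomial of the piece is a combination of the spanning polynomials, so it occurs with
    nonzero coefficient in one of them; their largest [msize] therefore bounds its degree. *)
Lemma finite_dim_mdeg_bound s : finite_dim (graded_piece R A s) ->
  exists D, forall a, multideg A a = s -> (mdeg a <= D)%N.
Proof.
move=> [n [b grE]]; exists (\max_i msize (b i))%N => a as_.
have : graded_piece R A s 'X_[a] by rewrite -as_; exact: graded_piece_monomial.
rewrite grE => -[l [c [v [vb /(congr1 (mcoeff a))]]]].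
rewrite mcoeffX eqxx raddf_sum /= => coef1.
have [i via] : exists i, (v i)@_a != 0.
  apply/existsP; apply: contraT; rewrite negb_exists => /forallP v0.
  move: coef1; rewrite big1 => [/eqP|i _]; first by rewrite oner_eq0.
  by have := v0 i; rewrite negbK mcoeffZ => /eqP ->; rewrite mulr0.
have [j _ vij] := vb i.
apply: leq_trans (leq_bigmax j); apply: ltnW; apply: msize_mdeg_lt.
by rewrite vij mcoeff_msupp.
Qed.

Lemma omega_below_finite m :
  finite_dim (graded_piece R A m) -> finite_set (omega_below R A m).
Proof.
move=> /finite_dim_mdeg_bound[D bD].
apply: (@sub_finite_set _ _
  [set multideg A (bmnm b) | b in [set: 'X_{1..N < D.+1}]]).
  move=> s [/omegaP[a as_] /omegaP[b bs]].
  (* If [a] has multidegree [s] and [b] has multidegree [m - s], then [a + b] has multidegree [m],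
     so [D] bounds its degree. *)
  have aD : (mdeg a < D.+1)%N.
    rewrite ltnS; apply: leq_trans (bD (a + b)%MM _); first by rewrite mdegD leq_addr.
    by rewrite multidegD as_ bs addrC subrK.
  by exists (BMultinom aD).
exact/finite_image/finite_finset.
Qed.

(** All multiples of [a] have multidegree 0; were [a] nonzero, their degrees would be unbounded. *)
Lemma multideg_eq0 a :
  finite_dim (graded_piece R A 0) -> multideg A a = 0 -> a = 0%MM.
Proof.
move=> /finite_dim_mdeg_bound[D bD] a0; apply/eqP; rewrite -mdeg_eq0.
have := bD (a *+ D.+1)%MM; rewrite multidegMn a0 mul0rn mdegMn => /(_ erefl).
by case: (mdeg a) => // d; rewrite mulSn leqNgt ltn_addr.
Qed.

(** Saturation reduces membership to the real cone, and the entries of [B *m s] keep their sign when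
    cast to [R]. *)
Lemma omega_ge0 (p : nat) (B : 'M[int]_(p, k)) s :
  omega_real R A = [set y | vec_ge0 (map_mx intr B *m y)] ->
  omega R A = [set s | omega_real R A (int_vec R s)] ->
  omega R A s <-> vec_ge0 (B *m s).
Proof.
move=> HB ->; rewrite /= HB /= /int_vec -map_mxM.
suff -> : vec_ge0 (map_mx intr (B *m s) : 'cV[R]_p) = vec_ge0 (B *m s) by [].
by apply: eq_forallb => i; rewrite mxE ler0z.
Qed.

End WeightMonoid.

(** * Invariants of a visit and of a round *)

Section Procedure.
Variables (k N p : nat) (A : 'M[int]_(k, N)) (B : 'M[int]_(p, k)).
Implicit Types (st : state k) (s : 'cV[int]_k) (l u : seq 'cV[int]_k).

(** The invariant of the Sorted list. An absent element has index [size l], so the inequality also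
    forces [s - col i A] to lie in [l]. *)
Definition precedes_steps l := forall s i, s \in l ->
  vec_ge0 (B *m (s - col i A)) -> (index (s - col i A)%R l < index s l)%N.

Lemma ready_sub l l' s :
  {subset l <= l'} -> ready A B l s -> ready A B l' s.
Proof.
move=> ll' /forallP rl; apply/forallP => i.
by case/orP: (rl i) => [/ll' ->|->]; rewrite ?orbT.
Qed.

(** Appending changes no index of an element of [l], and readiness puts every admissible predecessor
    of the new element in [l]. *)
Lemma precedes_steps_rcons l s : s \notin l -> ready A B l s ->
  precedes_steps l -> precedes_steps (rcons l s).
Proof.
move=> sl /forallP rs pl t i; rewrite mem_rcons inE -cats1 !index_cat.
have [-> _ ge0|_ /= tl ge0] := eqVneq t s.
  have := rs i; rewrite ge0 orbF => sil.
  by rewrite sil (negPf sl) ltn_addr // index_mem.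
have lt_t := pl t i tl ge0.
by rewrite tl -index_mem (ltn_trans lt_t) // index_mem.
Qed.

Lemma visit_perm st s : s \in st.1 ->
  perm_eq ((visit A B st s).1 ++ (visit A B st s).2) (st.1 ++ st.2).
Proof.
rewrite /visit; case: ifP => //= _ sU.
rewrite -cats1 catA perm_catC /= -cat_cons perm_cat2r perm_sym.
exact: perm_to_rem.
Qed.

Lemma visit_steps st s : uniq (st.1 ++ st.2) -> s \in st.1 ->
  precedes_steps st.2 -> precedes_steps (visit A B st s).2.
Proof.
rewrite /visit cat_uniq => /and3P[_ /hasPn disj _] sU.
case: ifP => //= rs; apply: precedes_steps_rcons => //.
by apply/negP => /disj; rewrite /= sU.
Qed.

Lemma mem_visit st s t : t != s -> t \in st.1 -> t \in (visit A B st s).1.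
Proof.
move=> ts tU; rewrite /visit; case: ifP => //= _.
have: t \in s :: rem s st.1.
  have [sU|sU] := boolP (s \in st.1); first by rewrite -(perm_mem (perm_to_rem sU)).
  by rewrite rem_id // inE tU orbT.
by rewrite inE (negPf ts).
Qed.

Lemma foldl_visit_inv u st : uniq u -> {subset u <= st.1} ->
  uniq (st.1 ++ st.2) -> precedes_steps st.2 ->
  perm_eq ((foldl (visit A B) st u).1 ++ (foldl (visit A B) st u).2)
    (st.1 ++ st.2) /\
  precedes_steps (foldl (visit A B) st u).2.
Proof.
elim: u st => [|s u IHu] st //= /andP[su uu] sub uq ps.
have sU : s \in st.1 by apply: sub; rewrite mem_head.
have vp := visit_perm sU.
have [||||perm ps'] := IHu (visit A B st s) => //.
- move=> t tu; apply: mem_visit; last by apply: sub; rewrite inE tu orbT.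
  by apply: contraNneq su => <-.
- by rewrite (perm_uniq vp).
- exact: visit_steps.
by split=> //; apply: perm_trans perm vp.
Qed.

Lemma visit_sorted_sub st s : {subset st.2 <= (visit A B st s).2}.
Proof.
move=> t tl; rewrite /visit; case: ifP => //= _.
by rewrite mem_rcons inE tl orbT.
Qed.

Lemma foldl_visit_sorted_sub u st :
  {subset st.2 <= (foldl (visit A B) st u).2}.
Proof.
elim: u st => [|s u IHu] st t tl //=.
exact/IHu/visit_sorted_sub.
Qed.

(** Sorted only grows during a round, so [s] is still ready when its turn comes. *)
Lemma foldl_visit_ready u st s :
  s \in u -> ready A B st.2 s -> s \in (foldl (visit A B) st u).2.
Proof.
elim: u st => [|t u IHu] st //=; rewrite inE => /predU1P[<-|su] rs.
  by apply: foldl_visit_sorted_sub; rewrite /visit rs /= mem_rcons mem_head.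
exact/IHu/(ready_sub (visit_sorted_sub _))/rs.
Qed.

Lemma pass_inv st st' : pass A B st st' ->
  uniq (st.1 ++ st.2) -> precedes_steps st.2 ->
  perm_eq (st'.1 ++ st'.2) (st.1 ++ st.2) /\ precedes_steps st'.2.
Proof.
move=> [u uU ->] uq ps; apply: foldl_visit_inv => //.
  by rewrite (perm_uniq uU); move: uq; rewrite cat_uniq => /andP[].
by move=> s; rewrite (perm_mem uU).
Qed.

Lemma pass_progress st st' s : pass A B st st' ->
  uniq (st.1 ++ st.2) -> precedes_steps st.2 ->
  s \in st.1 -> ready A B st.2 s -> (size st'.1 < size st.1)%N.
Proof.
move=> pst uq ps sU rs; have [perm _] := pass_inv pst uq ps.
have lt2 : (size st.2 < size st'.2)%N.
  case: pst perm => u uU -> perm.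
  have sl : s \notin st.2.
    move: uq; rewrite cat_uniq => /and3P[_ /hasPn disj _].
    by apply/negP => /disj; rewrite /= sU.
  apply: (@uniq_leq_size _ (s :: st.2)) => [|t].
    by rewrite /= sl; move: uq; rewrite cat_uniq => /and3P[].
  rewrite inE => /predU1P[->|]; last exact: foldl_visit_sorted_sub.
  by apply: foldl_visit_ready => //; rewrite (perm_mem uU).
(* The total size is preserved, so Unsorted loses what Sorted gains. *)
have := perm_size perm; rewrite !size_cat => sz.
by rewrite -(ltn_add2r (size st'.2)) sz ltn_add2l.
Qed.

End Procedure.

(** * Termination and the order of the output *)

Section Runs.
Variables (R : realType) (k N p : nat).
Variables (A : 'M[int]_(k, N)) (B : 'M[int]_(p, k)) (m : 'cV[int]_k).
Hypothesis Hfin : forall s, finite_dim (graded_piece R A s).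
Hypothesis omegaB : forall s, omega R A s <-> vec_ge0 (B *m s).

Lemma exists_ready st s :
  (forall t i, t \in st.1 -> vec_ge0 (B *m (t - col i A)) ->
     t - col i A \in st.1 ++ st.2) ->
  s \in st.1 -> exists2 t, t \in st.1 & ready A B st.2 t.
Proof.
move=> down sU; have [D bD] := finite_dim_mdeg_bound (Hfin s).
(* Adding [U_(i)] to an exponent of [t - col i A] gives an exponent of [t], of degree one higher. *)
have drop d t i b : (forall a, multideg A a = t -> (mdeg a <= d)%N) ->
    multideg A b = t - col i A -> (mdeg b < d)%N.
  move=> bd bti; have := bd (b + U_(i))%MM.
  by rewrite multidegD multidegU bti subrK mdegD mdeg1 addn1; apply.
elim: D s bD sU => [|D IHD] s bD sU;
  (have [rs|] := boolP (ready A B st.2 s); first by exists s);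
  rewrite /ready negb_forall => /existsP[j];
  rewrite negb_or negbK => /andP[sil ge0].
(* With bound 0, the missing predecessor would have an exponent of negative degree. *)
- have [b bE] : exists b, multideg A b = s - col j A.
    exact/(@omegaP R)/omegaB.
  by have := drop _ _ _ _ bD bE.
- apply: (IHD (s - col j A)) => [b bE|]; first exact: drop bD bE.
  by have := down s j sU ge0; rewrite mem_cat (negPf sil) orbF.
Qed.

Lemma omega_below_step s i : omega_below R A m s ->
  omega R A (s - col i A) -> omega_below R A m (s - col i A).
Proof.
move=> [_ sm] si; split=> //; rewrite /prec_omega opprB addrA addrAC.
exact: omegaD (omega_col R A i).
Qed.

Lemma omega_below0 : omega R A m -> omega_below R A m 0.
Proof. by split; [exact: omega0 | rewrite /prec_omega subr0]. Qed.

(** The condition is vacuous: if [- col i A] had an exponent [b], the nonzero [b + U_(i)] would have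
    multidegree 0. *)
Lemma precedes_steps0 : precedes_steps A B [:: 0].
Proof.
move=> s i; rewrite inE => /eqP -> /omegaB/omegaP[b]; rewrite sub0r => bi.
have := @multideg_eq0 R _ _ A (b + U_(i))%MM (Hfin 0).
rewrite multidegD multidegU bi addNr => /(_ erefl) /(congr1 mdeg).
by rewrite mdegD mdeg1 mdeg0 addn1.
Qed.

Variable run : nat -> state k.
Hypothesis Hm : omega R A m.
Hypothesis Hrun : sort_run R A B m run.

Lemma run_inv n :
  [/\ uniq ((run n).1 ++ (run n).2),
      forall s, s \in (run n).1 ++ (run n).2 <-> omega_below R A m s
    & precedes_steps A B (run n).2].
Proof.
have [uq0 mem0 sorted0 Hpass] := Hrun.
elim: n => [|n [uq mem ps]].
  rewrite sorted0; split; last exact: precedes_steps0.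
    rewrite cats1 rcons_uniq uq0 andbT.
    by apply/negP => /mem0 [_ /(_ erefl)].
  move=> s; rewrite cats1 mem_rcons inE; split.
    by case/predU1P => [->|/mem0 [] //]; apply: omega_below0.
  move=> sm; have [->//|/eqP s0 /=] := eqVneq s 0.
  by apply/mem0.
have [perm ps'] := pass_inv (Hpass n) uq ps.
split=> //; first by rewrite (perm_uniq perm).
by move=> s; rewrite (perm_mem perm).
Qed.

Lemma run_decreases n : (run n).1 <> [::] ->
  (size (run n.+1).1 < size (run n).1)%N.
Proof.
have [uq mem ps] := run_inv n.
have [_ _ _ Hpass] := Hrun.
move=> U0; have [s sU] : exists s, s \in (run n).1.
  by case: (run n).1 U0 => // s U _; exists s; exact: mem_head.
have [t i tU ge0|t tU rt] := exists_ready _ sU.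
  apply/mem/omega_below_step; last exact/omegaB.
  by apply/mem; rewrite mem_cat tU.
exact: pass_progress (Hpass n) uq ps tU rt.
Qed.

Lemma run_halts : exists out, run_returns run out.
Proof.
have ex0 : exists n, (run n).1 == [::].
  apply: contrapT => /forallNP nonempty.
  (* Each round before halting removes at least one element, so more rounds than initial elements
     are impossible. *)
  have bound n : (size (run n).1 + n <= size (run 0%N).1)%N.
    elim: n => [|n]; first by rewrite addn0.
    by apply: leq_trans; rewrite addnS -addSn leq_add2r run_decreases //; apply/eqP/negP.
  have := bound (size (run 0%N).1).+1.
  by rewrite addnS ltnNge leq_addl.
have [n /eqP Un minn] := ex_minnP ex0.
exists (run n).2, n; split=> // j jn Uj.
by have := minn j; rewrite Uj eqxx leqNgt jn => /(_ isT).
Qed.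

(** Induction on a bound for the degree of [c]: peel off one [U_(i)], apply the invariant, and
    continue from [s + multideg A c']. *)
Lemma steps_index l s c : precedes_steps A B l -> c <> 0%MM ->
  omega R A s -> s + multideg A c \in l ->
  (index s l < index (s + multideg A c)%R l)%N.
Proof.
move=> pl; move: {2}(mdeg c) (leqnn (mdeg c)) => d.
elim: d c => [|d IHd] c cd c0 sA; first by move: cd; rewrite leqn0 mdeg_eq0 => /eqP.
have [i [c' cE]] := mnm_neq0_split c0.
have stepE : s + multideg A c - col i A = s + multideg A c'.
  by rewrite cE multidegD multidegU addrA addrK.
move=> scl; have : (index (s + multideg A c')%R l < index (s + multideg A c)%R l)%N.
  rewrite -stepE; apply: pl => //; rewrite stepE.
  by apply/omegaB/omegaD => //; apply/omegaP; exists c'.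
have [c'0|/eqP c'0] := eqVneq c' 0%MM; first by rewrite c'0 multideg0 addr0.
move=> lt; apply: ltn_trans (lt); apply: IHd => //.
  by move: cd; rewrite cE mdegD mdeg1 addn1.
(* The intermediate point lies in [l] because its index is below that of a member. *)
by rewrite -index_mem (ltn_trans lt) // index_mem.
Qed.

Lemma run_linear_extension out : run_returns run out ->
  linear_extension (prec_omega R A) (omega_below R A m) out.
Proof.
move=> [n [_ Un <-]]; have [] := run_inv n.
rewrite Un /= => uq mem ps; split=> // s s' [os _] /mem s'l /omegaP[c cE] ss'.
have s'E : s' = s + multideg A c by rewrite cE addrC subrK.
rewrite s'E in s'l ss' *; apply: steps_index => // c0.
by apply: ss'; rewrite c0 multideg0 addr0.
Qed.

End Runs.

Theorem theorem5p2 (R : realType) (k N p : nat)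
    (A : 'M[int]_(k, N)) (B : 'M[int]_(p, k)) (m : 'cV[int]_k)
    (Hfin : forall s : 'cV[int]_k, finite_dim (graded_piece R A s))
    (HB : omega_real R A = [set y | vec_ge0 (map_mx intr B *m y)])
    (Hsat : omega R A = [set s | omega_real R A (int_vec R s)])
    (Hm : omega R A m) :
  sort_terminates R A B m /\
  forall out : seq 'cV[int]_k, sort_output R A B m out ->
    linear_extension (prec_omega R A) (omega_below R A m) out.
Proof.
have omegaB s : omega R A s <-> vec_ge0 (B *m s) by exact: omega_ge0.
split=> [|out [run Hrun]]; last exact: (run_linear_extension Hfin omegaB Hm Hrun).
split=> [|run]; last exact: run_halts.
by apply: sub_finite_set (omega_below_finite (Hfin m)) => s [].
Qed.
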